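(* Let $\mathcal B$ be a real Banach space and let $(T_t)_{t\ge0}$ be a $\mathcal C_0$-semigroup on $\mathcal B$ such that, for some $r$, $T_t$ is compact for all $t\ge r$. Let $L:\mathcal D(L)\to\mathcal B$ be its infinitesimal generator and let $\{\lambda_j\}_{j\ge1}$ be the Lyapunov exponents of the semigroup. If $\mu\in P\sigma(L)$, then there exist $j\ge1$ and $b\in\mathbb R$ such that $\mu=\lambda_j+ib$. Furthermore, for every $\lambda_j\ne-\infty$ there exists $b\in\mathbb R$ such that $\lambda_j+ib\in P\sigma(L)$.
   Context: $P\sigma(L)$ is the point spectrum of $L$, i.e. the set of $\lambda\in\mathbb C$ for which $\lambda I-L$ (on the complexification of $\mathcal B$) is not injective. Lyapunov exponents: for a $\mathcal C_0$-semigroup that is compact for $t>r$, the Multiplicative Ergodic Theorem gives a decreasing sequence $\lambda_i\in[-\infty,\infty)$, with $\lim_n\lambda_n=-\infty$ and either $\lambda_i>\lambda_{i+1}$ or $\lambda_i=\lambda_{i+1}=-\infty$, such that with $F_{\lambda_i}:=\{x\in\mathcal B:\limsup_{t\to\infty}\frac1t\log\|T_tx\|_{\mathcal B}\le\lambda_i\}$ one has $\dots\subset F_{\lambda_2}\subset F_{\lambda_1}=\mathcal B$; $x\in F_{\lambda_i}\setminus F_{\lambda_{i+1}}$ iff $\lim_{t\to\infty}\frac1t\log\|T_tx\|_{\mathcal B}=\lambda_i$; the spaces $F_{\lambda_j}$ have finite codimension; and for each $i$ with $\lambda_i>\lambda_{i+1}$ there is a unique nonzero finite-dimensional $H^i$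 with $T_t(H^i)=H^i$ for all $t\ge0$, $H^i\oplus F_{\lambda_{i+1}}=F_{\lambda_i}$, and $\lim_{t\to\infty}\frac1t\log\|T_th\|=\lambda_i$, $\lim_{t\to\infty}\frac1t\log\|(T_t|_{H^i})^{-1}h\|=-\lambda_i$ for $h\in H^i\setminus\{0\}$. *)

(* Defs.v *)
From HB Require Import structures.
From mathcomp Require Import all_boot all_order all_algebra.
From mathcomp Require Import all_classical all_reals all_analysis.
From mathcomp Require Import complex.
Set Implicit Arguments.
Unset Strict Implicit.
Unset Printing Implicit Defensive.
Import Order.TTheory GRing.Theory Num.Theory.
Import numFieldNormedType.Exports.
Local Open Scope classical_set_scope.
Local Open Scope ring_scope.

(* (x, y) stands for x + i y. *)
Definition complexification (R : rcfType) (B : lmodType R) : Type := (B * B)%type.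

Section Complexification.
Context (R : rcfType) (B : lmodType R).

HB.instance Definition _ := GRing.Zmodule.on (complexification B).

Definition cplx_scale (c : R[i]) (z : complexification B) : complexification B :=
  (complex.Re c *: z.1 - complex.Im c *: z.2,
   complex.Im c *: z.1 + complex.Re c *: z.2).

Lemma cplx_scaleA a b z : cplx_scale a (cplx_scale b z) = cplx_scale (a * b) z.
Proof.
case: a b z => [a1 a2] [b1 b2] [x y]; rewrite /cplx_scale /=.
congr pair => /=; rewrite ?scalerBr ?scalerDr !scalerA ?scalerBl !scalerDl.
  by rewrite !opprD addrACA [X in _ + X]addrC.
by rewrite addrACA; congr (_ + _); rewrite addrC.
Qed.

Lemma cplx_scale1 : left_id 1 cplx_scale.
Proof.
by case=> x y; rewrite /cplx_scale /= !scale1r !scale0r subr0 add0r.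
Qed.

Lemma cplx_scaleDr : right_distributive cplx_scale +%R.
Proof.
move=> c [x y] [x' y']; rewrite /cplx_scale /=; congr pair => /=.
  by rewrite !scalerDr opprD addrACA.
by rewrite !scalerDr addrACA.
Qed.

Lemma cplx_scaleDl z : {morph cplx_scale^~ z : a b / a + b}.
Proof.
case: z => x y [a1 a2] [b1 b2]; rewrite /cplx_scale /=; congr pair => /=.
  by rewrite !scalerDl opprD addrACA.
by rewrite !scalerDl addrACA.
Qed.

HB.instance Definition _ := GRing.Zmodule_isLmodule.Build R[i]
  (complexification B) cplx_scaleA cplx_scale1 cplx_scaleDr cplx_scaleDl.

Definition cplx_dom (D : set B) : set (complexification B) :=
  [set z | D z.1 /\ D z.2].

Definition cplx_op (A : B -> B) (z : complexification B) : complexification B :=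
  (A z.1, A z.2).

Definition point_spectrum (D : set B) (A : B -> B) : set R[i] :=
  [set mu | ~ set_inj (cplx_dom D) (fun z => mu *: z - cplx_op A z)].

Definition finite_dim (V : set B) : Prop :=
  exists (n : nat) (e : 'I_n -> B),
    V = range (fun c : 'I_n -> R => \sum_(k < n) c k *: e k).

Definition direct_sum (V W U : set B) : Prop :=
  [set v + w | v in V & w in W] = U /\ V `&` W = [set 0].

Definition finite_codim (V : set B) : Prop :=
  exists W : set B, finite_dim W /\ direct_sum W V setT.

End Complexification.

Section Semigroup.
Context (R : realType) (B : normedModType R).

Definition compact_operator (f : B -> B) : Prop :=
  forall A : set B, bounded_set A -> precompact (f @` A).

(* Only the values T t with 0 <= t are meaningful. *)
Record C0_semigroup (T : R -> B -> B) : Prop := {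
  C0_linear : forall t : R, 0 <= t -> linear (T t);
  C0_continuous : forall t : R, 0 <= t -> continuous (T t);
  C0_id : forall x, T 0 x = x;
  C0_add : forall (s t : R) x, 0 <= s -> 0 <= t -> T (s + t) x = T s (T t x);
  C0_strong : forall x, T t x @[t --> 0^'+] --> x }.

Definition generator_dom (T : R -> B -> B) : set B :=
  [set x | cvg (t^-1 *: (T t x - x) @[t --> 0^'+])].

Definition generator (T : R -> B -> B) (x : B) : B :=
  lim (t^-1 *: (T t x - x) @[t --> 0^'+]).

(* [lne 0 = -oo], so a trajectory that vanishes has log-norm -oo. *)
Definition log_rate (u : R -> B) (t : R) : \bar R :=
  ((t^-1)%:E * lne `|u t|%:E)%E.

Definition growth_space (T : R -> B -> B) (a : \bar R) : set B :=
  [set x | (limf_esup (log_rate (T^~ x)) +oo%R <= a)%E].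

Record oseledets_space (T : R -> B -> B) (a a' : \bar R) (H : set B) : Prop := {
  oseledets_dim : finite_dim H;
  oseledets_neq0 : H <> [set 0];
  oseledets_inv : forall t : R, 0 <= t -> T t @` H = H;
  oseledets_sum : direct_sum H (growth_space T a') (growth_space T a);
  oseledets_fwd : forall h, H h -> h <> 0 ->
    log_rate (T^~ h) t @[t --> +oo] --> a;
  oseledets_bwd : forall h, H h -> h <> 0 ->
    log_rate (fun t => 'pinv_(fun=> 0) H (T t) h) t @[t --> +oo] --> (- a)%E }.

(* The sequence provided by the multiplicative ergodic theorem, indexed from 0;
   these properties determine it.  The characterization of
   F_(lambda i) \ F_(lambda i.+1) only makes sense when
   lambda i.+1 < lambda i: once both are -oo the difference is empty, although
   some x (such as 0) do have exponent -oo. *)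
Record lyapunov_exponents (T : R -> B -> B) (lambda : nat -> \bar R) : Prop := {
  lyap_lty : forall i, (lambda i < +oo)%E;
  lyap_decr : forall i, (lambda i.+1 < lambda i)%E \/
                        lambda i = -oo%E /\ lambda i.+1 = -oo%E;
  lyap_lim : lambda i @[i --> \oo] --> -oo%E;
  lyap_setT : growth_space T (lambda 0) = setT;
  lyap_sub : forall i,
    growth_space T (lambda i.+1) `<=` growth_space T (lambda i);
  lyap_rate : forall i, (lambda i.+1 < lambda i)%E -> forall x,
    (growth_space T (lambda i) `\` growth_space T (lambda i.+1)) x <->
    (log_rate (T^~ x) t @[t --> +oo] --> lambda i);
  lyap_codim : forall i, finite_codim (growth_space T (lambda i));
  lyap_oseledets : forall i, (lambda i.+1 < lambda i)%E ->
    exists! H : set B, oseledets_space T (lambda i) (lambda i.+1) H }.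

End Semigroup.

(* Main.v *)
Require Import Defs.
From HB Require Import structures.
From mathcomp Require Import all_boot all_order all_algebra.
From mathcomp Require Import all_classical all_reals all_analysis.
From mathcomp Require Import complex.
From mathcomp Require Import ring lra.
Set Implicit Arguments.
Unset Strict Implicit.
Unset Printing Implicit Defensive.
Import Order.TTheory GRing.Theory Num.Theory.
Import numFieldNormedType.Exports.
Local Open Scope classical_set_scope.
Local Open Scope ring_scope.

(** The semigroup acts on a complex eigenvector [x + i y] of its generator,
    with eigenvalue [a + i b], as multiplication by [exp ((a + i b) t)].  At
    the multiples of [2 pi / |b|] (at all times if [b = 0]) the rotation
    disappears and the real part is multiplied by a pure exponential:
    [T_t x = exp (a t) x].  So [log |T_t x| / t] tends to [a] along these
    times, and this pins the growth of [x]: if it has a limit then the limit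
    is [a], and in any case its upper limit is at least [a].

    From an eigenvalue to an exponent ([eigenpair_lyapunov]): since the
    exponents decrease to [-oo], the lower bound on the upper limit puts [x]
    outside some growth space; [x] therefore lies in one difference
    [F_j \ F_(j+1)], where the rate converges to [lambda_j], and so
    [lambda_j = a].

    From an exponent to an eigenvalue: the Oseledets space [H] of a finite
    exponent is finite dimensional and invariant.  In a basis of [H] the
    semigroup is a continuous matrix semigroup, hence differentiable at [0]
    ([matrix_semigroup_derivable]), so [H] lies in the domain of the generator,
    which acts on it as a real matrix ([invariant_space_generator]).  This
    matrix has a complex eigenvector, whose real and imaginary parts have rate
    [lambda_j] because they lie in [H], and have rate [a] along a sequence by
    the first paragraph; so the real part of the eigenvalue is [lambda_j].

    The norm estimates rest on the Banach-Steinhaus theorem, which makes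
    [|T_t|] bounded for [t] in a bounded interval ([semigroup_bounded]). *)

(** * Local boundedness *)

Section SemigroupBounds.
Context (R : realType) (B : completeNormedModType R) (T : R -> B -> B).
Context (hT : C0_semigroup T).

Definition semigroup_map (t : R) (t0 : 0 <= t) : {linear B -> B} :=
  HB.pack (T t) (GRing.isLinear.Build _ _ _ _ (T t) (C0_linear hT t0)).

Lemma semigroupD (t : R) x y : 0 <= t -> T t (x + y) = T t x + T t y.
Proof. by move=> t0; exact: (linearD (semigroup_map t0)). Qed.

Lemma semigroupN (t : R) x : 0 <= t -> T t (- x) = - T t x.
Proof. by move=> t0; exact: (linearN (semigroup_map t0)). Qed.

Lemma semigroupB (t : R) x y : 0 <= t -> T t (x - y) = T t x - T t y.
Proof. by move=> t0; exact: (linearB (semigroup_map t0)). Qed.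

Lemma semigroupZ (t a : R) x : 0 <= t -> T t (a *: x) = a *: T t x.
Proof. by move=> t0; exact: (linearZ_LR (semigroup_map t0)). Qed.

Lemma semigroup_sum (t : R) n (c : 'I_n -> R) (e : 'I_n -> B) : 0 <= t ->
  T t (\sum_k c k *: e k) = \sum_k c k *: T t (e k).
Proof.
move=> t0; rewrite -[LHS]/(semigroup_map t0 _) linear_sum.
by apply: eq_bigr => k _; exact: (linearZ_LR (semigroup_map t0)).
Qed.

Lemma semigroup_bounded_fun_norm (t : R) : 0 <= t -> bounded_fun_norm (T t).
Proof.
move=> t0; apply/(bounded_funP (semigroup_map t0)).
exact/linear_bounded_continuous/(C0_continuous hT t0).
Qed.

(** If there were times tending to [0] at which the operator norms tend to
    infinity, the family of these operators would be bounded at every point by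
    strong continuity, which contradicts Banach-Steinhaus. *)
Lemma semigroup_bounded_near0 : exists d C : R, [/\ 0 < d, 1 <= C &
  forall (t : R) x, 0 <= t -> t <= d -> `|T t x| <= C * `|x|].
Proof.
have [n hn] : exists n : nat, forall t : R, 0 <= t -> t <= n.+1%:R^-1 ->
    forall x, `|x| <= 1 -> `|T t x| <= n%:R.
  apply: contrapT => /forallNP hbad.
  have /choice[s hs] : forall n : nat, exists t : R, [/\ 0 <= t, t <= n.+1%:R^-1 &
      exists2 x, `|x| <= 1 & n%:R < `|T t x| ].
    move=> n; apply: contrapT => h; apply: (hbad n) => t t0 tn x x1.
    by rewrite leNgt; apply/negP => hx; apply: h; exists t; split => //; exists x.
  have /Banach_Steinhauss ub : forall f, range (fun n => T (s n)) f ->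
      bounded_fun_norm f /\ linear f.
    move=> _ [n _ <-]; have [s0 _ _] := hs n.
    by split; [exact: semigroup_bounded_fun_norm|exact: (C0_linear hT)].
  have pb : pointwise_bounded (range (fun n => T (s n))).
    move=> x.
    have /cvgrPdist_le/(_ 1 ltr01) := @C0_strong _ _ _ hT x.
    case=> e /= e0 he.
    have bnd t : 0 <= t -> t < e -> `|T t x| <= `|x| + 1.
      rewrite le_eqVlt => /orP[/eqP<-|t0 te].
        by rewrite (C0_id hT) lerDl.
      have := he t; rewrite /= sub0r normrN gtr0_norm// => /(_ te t0) h.
      rewrite -[T t x](subrK x) addrC (le_trans (ler_normD _ _))//.
      by rewrite lerD2l distrC.
    (* The finitely many times that may exceed [e] are bounded by their sum. *)
    pose N := Num.truncn e^-1.
    exists (`|x| + 1 + \sum_(i < N) `|T (s i) x|) => _ [n _ <-].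
    have [nN|Nn] := ltnP n N.
      by rewrite (bigD1 (Ordinal nN))//= addrCA lerDl !addr_ge0 ?sumr_ge0//.
    rewrite (le_trans (bnd _ _ _)) ?lerDl ?sumr_ge0//; first by have [] := hs n.
    have [_ /le_lt_trans + _] := hs n; apply.
    rewrite invf_plt ?posrE//; apply: lt_le_trans (truncnS_gt _) _.
    by rewrite ler_nat ltnS.
  have [M hM] := ub pb 1.
  have [_ _ [x x1]] := hs (Num.truncn M).+1.
  apply/negP; rewrite -leNgt (le_trans (hM _ _ _ x1))//.
  by apply/ltW/truncnS_gt.
exists n.+1%:R^-1, (n%:R + 1); split => [||t x t0 tn].
- by rewrite invr_gt0.
- by rewrite lerDr.
have [->|x0] := eqVneq x 0.
  by have := semigroupB 0 0 t0; rewrite !subrr => ->; rewrite normr0 mulr0.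
have := hn t t0 tn (`|x|^-1 *: x).
rewrite semigroupZ// !normrZ normfV normr_id mulVf ?normr_eq0// => /(_ (lexx _)).
rewrite mulrC ler_pdivrMr ?normr_gt0// => /le_trans; apply.
by rewrite ler_wpM2r// lerDl.
Qed.

Lemma semigroup_bounded (tau : R) : exists2 C : R, 1 <= C &
  forall (t : R) x, 0 <= t -> t <= tau -> `|T t x| <= C * `|x|.
Proof.
have [d [C [d0 C1 hC]]] := semigroup_bounded_near0.
have C0 : 0 <= C by exact: le_trans C1.
exists (C ^+ (Num.truncn (tau / d)).+1); first by rewrite exprn_ege1.
move=> t x t0 ttau.
have : t <= (Num.truncn (tau / d)).+1%:R * d.
  by rewrite -ler_pdivrMr// ltW// (le_lt_trans _ (truncnS_gt _))// ler_pM2r ?invr_gt0.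
elim: (Num.truncn _).+1 t x t0 {ttau} => [|k IH] t x t0 tk.
  have -> : t = 0 by apply/eqP; rewrite eq_le t0 andbT (le_trans tk)// mul0r.
  by rewrite (C0_id hT) expr0 mul1r.
have [td|dt] := leP t d.
  apply: le_trans (hC _ _ t0 td) _.
  by rewrite ler_wpM2r// exprS ler_peMr// exprn_ege1.
have td0 : 0 <= t - d by rewrite subr_ge0 ltW.
rewrite -(subrK d t) addrC (C0_add hT _ (ltW d0) td0).
apply: le_trans (hC _ _ (ltW d0) (lexx _)) _.
rewrite exprS -mulrA ler_wpM2l//; apply: IH => //.
by rewrite lerBlDr -[X in _ + X]mul1r -mulrDl -natr1 in tk *.
Qed.

End SemigroupBounds.

(** * Orbits of eigenvectors *)

Section RightDerivative.
Context (R : realType) (V : normedModType R).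

(** A function whose right difference quotients vanish uniformly is constant:
    cutting [[0, tau]] into [n] equal steps bounds the total increment by
    [n * eps (tau / n)].  Only increments to the right are used, which is what
    the semigroup law controls. *)
Lemma eq_of_small_increments (f : R -> V) (eps : R -> R) (tau : R) :
  0 <= tau ->
  (forall t h, 0 <= t -> 0 <= h -> t + h <= tau -> `|f (t + h) - f t| <= eps h) ->
  h^-1 * eps h @[h --> 0^'+] --> (0 : R) -> f tau = f 0.
Proof.
rewrite le_eqVlt => /orP[/eqP<-//|tau0] fe e0.
apply/eqP; rewrite -subr_eq0 -normr_le0; apply/ler_addgt0Pl => d d0.
have /cvgrPdist_le/(_ (d / tau) (divr_gt0 d0 tau0))[eta /= eta0 heta] := e0.
pose n := (Num.truncn (tau / eta)).+1.
have n0 : 0 < n%:R :> R by rewrite ltr0n.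
pose h := tau / n%:R.
have h0 : 0 < h by rewrite divr_gt0.
have heta' : h < eta.
  by rewrite /h ltr_pdivrMr// mulrC -ltr_pdivrMr// truncnS_gt.
have eh : eps h <= d / tau * h.
  have := heta h; rewrite /= !sub0r normrN gtr0_norm// => /(_ heta' h0).
  rewrite normrN => /(le_trans (ler_norm _)).
  by rewrite mulrC ler_pdivrMr.
have nh : n%:R * h = tau by rewrite /h mulrCA divff ?mulr1// gt_eqF.
suff step k : (k <= n)%N -> `|f (k%:R * h) - f 0| <= k%:R * eps h.
  have := step n (leqnn n); rewrite nh => /le_trans; apply.
  rewrite addr0 (le_trans (ler_wpM2l (ltW n0) eh))//.
  by rewrite mulrCA nh divfK// gt_eqF.
elim: k => [_|k IH kn]; first by rewrite !mul0r subrr normr0.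
rewrite -(subrK (f (k%:R * h)) (f _)) -addrA (le_trans (ler_normD _ _))//.
rewrite -natr1 !mulrDl !mul1r [leRHS]addrC lerD ?IH// 1?ltnW// fe//.
- by rewrite mulr_ge0// ltW.
- exact: ltW.
by rewrite -[X in _ + X]mul1r -mulrDl natr1 -nh ler_pM2r// ler_nat.
Qed.

End RightDerivative.

Lemma is_derive_right (R : realType) (f : R -> R) (x df : R) :
  is_derive x (1 : R) f df -> h^-1 * (f (x + h) - f x) @[h --> 0^'+] --> df.
Proof.
case=> fx <-; have /cvg_dnbhs_at_right := fx.
apply: cvg_trans; apply: near_eq_cvg; near=> h.
by rewrite /= -[h *: 1]/(h * 1) mulr1 [h + x]addrC.
Unshelve. all: by end_near. Qed.

Section Eigenpair.
Context (R : realType) (B : completeNormedModType R) (T : R -> B -> B).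
Context (hT : C0_semigroup T) (a b : R).

(** The real form of [L (x + i y) = (a + i b) (x + i y)], with [L] written as
    the right derivative of the semigroup at [0]. *)
Definition real_eigenpair (x y : B) : Prop :=
  h^-1 *: (T h x - x) @[h --> 0^'+] --> a *: x - b *: y /\
  h^-1 *: (T h y - y) @[h --> 0^'+] --> b *: x + a *: y.

(** Multiplying [x + i y] by [- i] gives [y - i x]; what is shown for the real
    part of an eigenvector thus applies to its imaginary part. *)
Lemma real_eigenpair_rot x y : real_eigenpair x y -> real_eigenpair y (- x).
Proof.
case=> hx hy; split; first by rewrite scalerN opprK addrC.
have -> : b *: y + a *: - x = - (a *: x - b *: y).
  by rewrite scalerN opprB.
move/cvgN : hx; apply: cvg_trans; apply: near_eq_cvg; near=> h.
have h0 : 0 <= h by near: h; exact: nbhs_right_ge.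
by rewrite (semigroupN hT _ h0) -[LHS]/(- (h^-1 *: (T h x - x))) -scalerN opprD.
Unshelve. all: by end_near. Qed.

(** [c t - i * s t] is [exp (- (a + i b) t)], and [U x y t] is the real part of
    [exp (- (a + i b) t) * T_t (x + i y)]. *)
Let c t := expR (- (a * t)) * cos (b * t).
Let s t := expR (- (a * t)) * sin (b * t).
Let U x y t := c t *: T t x + s t *: T t y.

Let c0 : c 0 = 1. Proof. by rewrite /c !mulr0 oppr0 expR0 cos0 mulr1. Qed.
Let s0 : s 0 = 0. Proof. by rewrite /s !mulr0 oppr0 expR0 sin0 mulr0. Qed.

Let derive_c : is_derive (0 : R) (1 : R) c (- a).
Proof.
rewrite /c; apply: is_derive_eq.
rewrite !mulr0 oppr0 expR0 cos0 sin0 oppr0 mul0r scaler0 add0r scale1r mul1r.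
by rewrite -[a *: 1]/(a * 1) mulr1.
Qed.

Let derive_s : is_derive (0 : R) (1 : R) s b.
Proof.
rewrite /s; apply: is_derive_eq.
rewrite !mulr0 oppr0 expR0 cos0 sin0 scale0r addr0 scale1r mul1r.
by rewrite -[b *: 1]/(b * 1) mulr1.
Qed.

Let right_derivative_U x y : real_eigenpair x y ->
  h^-1 *: (U x y h - x) @[h --> 0^'+] --> (0 : B).
Proof.
case=> hx hy.
have dc := is_derive_right derive_c; have ds := is_derive_right derive_s.
have idc : c h @[h --> 0^'+] --> (1 : R).
  rewrite -c0; apply: cvg_at_right_filter; apply: differentiable_continuous.
  by apply/derivable1_diffP; case: derive_c.
have ids : s h @[h --> 0^'+] --> (0 : R).
  rewrite -[X in _ --> X]s0; apply: cvg_at_right_filter.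
  by apply: differentiable_continuous; apply/derivable1_diffP; case: derive_s.
have -> : (0 : B) = (1 : R) *: (a *: x - b *: y) + (0 : R) *: (b *: x + a *: y)
    + (- a *: x + b *: y).
  by rewrite scale1r scale0r addr0 scaleNr addrACA subrr addNr addr0.
apply: cvg_trans; last first.
  apply: (cvgD (cvgD (cvgZ idc hx) (cvgZ ids hy)) (cvgD (cvgZr_tmp dc) (cvgZr_tmp ds))).
apply: near_eq_cvg; near=> h.
rewrite /U.
rewrite -[LHS]/(c h *: (h^-1 *: (T h x - x)) + s h *: (h^-1 *: (T h y - y)) +
  ((h^-1 * (c (0 + h) - c 0)) *: x + (h^-1 * (s (0 + h) - s 0)) *: y)).
rewrite add0r c0 s0 subr0; move: (c h) (s h) => ch sh.
rewrite !scalerA ![_ * h^-1]mulrC -!scalerA -!scalerDr; congr (_ *: _).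
rewrite scalerBl scale1r !scalerBr.
by rewrite addrACA [X in X + _ = _]subrKA subrK addrAC.
Unshelve. all: by end_near. Qed.

Let cD t u : c (t + u) = c t * c u - s t * s u.
Proof. by rewrite /c /s !mulrDr cosD opprD expRD; ring. Qed.

Let sD t u : s (t + u) = s t * c u + c t * s u.
Proof. by rewrite /c /s !mulrDr sinD opprD expRD; ring. Qed.

(** The function [U x y] is constant: by the semigroup law its increment from
    [u] to [u + h] is the image under bounded operators of its increments from
    [0] to [h], and these are [o(h)]. *)
Lemma eigenpair_orbit x y t : real_eigenpair x y -> 0 <= t ->
  expR (- (a * t)) *: (cos (b * t) *: T t x + sin (b * t) *: T t y) = x.
Proof.
move=> xy t0.
have U0 u v : U u v 0 = u by rewrite /U c0 s0 (C0_id hT) scale1r scale0r addr0.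
rewrite scalerDr !scalerA -/(c t) -/(s t) -[LHS]/(U x y t).
rewrite -[RHS](U0 x y).
have [C C1 hC] := semigroup_bounded hT t.
have C0 : 0 <= C by exact: le_trans C1.
have [/right_derivative_U ex /right_derivative_U ey] := (xy, real_eigenpair_rot xy).
have expb u : 0 <= u -> u <= t -> expR (- (a * u)) <= expR (`|a| * t).
  move=> u0 ut; rewrite ler_expR -mulNr (le_trans (ler_wpM2r u0 (ler_norm _)))//.
  by rewrite normrN ler_wpM2l.
have cb u : 0 <= u -> u <= t -> `|c u| <= expR (`|a| * t).
  move=> u0 ut; rewrite /c normrM ger0_norm ?expR_ge0//.
  rewrite (le_trans _ (expb u u0 ut))// ler_piMr ?expR_ge0//.
  by rewrite ler_norml cos_geN1 cos_le1.
have sb u : 0 <= u -> u <= t -> `|s u| <= expR (`|a| * t).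
  move=> u0 ut; rewrite /s normrM ger0_norm ?expR_ge0//.
  rewrite (le_trans _ (expb u u0 ut))// ler_piMr ?expR_ge0//.
  by rewrite ler_norml sin_geN1 sin_le1.
pose K := expR (`|a| * t) * C.
apply: (@eq_of_small_increments _ _ _
  (fun h => K * `|U x y h - x| + K * `|U y (- x) h - y|)) => //.
  move=> u h u0 h0 uht.
  have ut : u <= t by rewrite (le_trans _ uht)// lerDl.
  have -> : U x y (u + h) - U x y u =
      c u *: T u (U x y h - x) + s u *: T u (U y (- x) h - y).
    rewrite !(semigroupB hT)// !(semigroupD hT)// !(semigroupZ hT)//.
    rewrite !(semigroupN hT)// /U !(C0_add hT)// cD sD.
    move: (c u) (s u) (c h) (s h) => cu su ch sh.
    rewrite scalerBl scalerDl -!scalerA scalerN !scalerBr !scalerDr.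
    rewrite [RHS]addrACA -opprD; congr (_ - _).
    by rewrite [_ *: _ + cu *: _]addrC addrACA [- _ + _]addrC.
  have bnd k z : `|k| <= expR (`|a| * t) -> `|k *: T u z| <= K * `|z|.
    by move=> kb; rewrite normrZ /K -mulrA ler_pM// hC.
  by rewrite (le_trans (ler_normD _ _))// lerD// bnd// ?cb ?sb.
have : K * `|h^-1 *: (U x y h - x)| + K * `|h^-1 *: (U y (- x) h - y)|
    @[h --> 0^'+] --> K * `|0 : B| + K * `|0 : B|.
  by apply: cvgD; apply: cvgM; (try exact: cvg_cst); apply: cvg_norm.
rewrite normr0 mulr0 addr0; apply: cvg_trans; apply: near_eq_cvg; near=> h.
have h0 : 0 <= h by near: h; exact: nbhs_right_ge.
by rewrite !normrZ ger0_norm ?invr_ge0//; ring.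
Unshelve. all: by end_near. Qed.

End Eigenpair.

(** * Growth rates of eigenvectors *)

Lemma limf_esup_ge_subseq (R : realType) (f : R -> \bar R) (u : nat -> R) (l : \bar R) :
  u n @[n --> \oo] --> +oo -> f (u n) @[n --> \oo] --> l ->
  (l <= limf_esup f +oo%R)%E.
Proof.
move=> uoo ful; rewrite limf_esupE; apply: le_ereal_inf_tmp => _ /= [A Aoo <-].
apply: (closed_cvg (fun z => z <= ereal_sup (f @` A))%E) ful.
  exact: closed_ereal_ge_ereal.
have : \forall n \near \oo, A (u n) by exact: uoo.
by apply: filterS => n An; apply: ereal_sup_ubound; exists (u n).
Qed.

Section Rates.
Context (R : realType) (B : completeNormedModType R) (T : R -> B -> B).
Context (hT : C0_semigroup T).

(** For [tau = 2 pi / |b|] (any [tau > 0] when [b = 0]) the rotation by the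
    angle [b * tau] is trivial. *)
Lemma eigenpair_recurrence (a b : R) x y : real_eigenpair T a b x y ->
  exists2 tau : R, 0 < tau &
    forall n, T (n%:R * tau) x = expR (a * (n%:R * tau)) *: x.
Proof.
move=> xy.
have [tau tau0 [ctau stau]] : exists2 tau : R, 0 < tau &
    cos (b * tau) = 1 /\ sin (b * tau) = 0.
  have [->|b0] := eqVneq b 0.
    by exists 1 => //; rewrite mul0r cos0 sin0.
  exists (pi *+ 2 / `|b|); first by rewrite divr_gt0 ?normr_gt0// mulrn_wgt0// pi_gt0.
  have [b_lt|b_gt|/eqP] := ltgtP b 0; last by rewrite (negbTE b0).
    rewrite ltr0_norm// (_ : b * _ = - (pi *+ 2)); last by field.
    by rewrite cosN sinN cos2pi sin2pi oppr0.
  by rewrite gtr0_norm// (_ : b * _ = pi *+ 2) ?cos2pi ?sin2pi//; field.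
exists tau => //.
have Ttau : T tau x = expR (a * tau) *: x.
  have := eigenpair_orbit hT xy (ltW tau0).
  rewrite ctau stau scale1r scale0r addr0 => {2}<-.
  by rewrite scalerA -expRD subrr expR0 scale1r.
elim=> [|n IH]; first by rewrite !mul0r mulr0 expR0 (C0_id hT) scale1r.
have n0 : 0 <= n%:R * tau by rewrite mulr_ge0// ltW.
rewrite -natr1 mulrDl mul1r addrC (C0_add hT _ (ltW tau0) n0) IH.
by rewrite (semigroupZ hT)// ?ltW// Ttau scalerA -expRD -mulrDr addrC.
Qed.

Lemma log_rate_exp (a t : R) x : x != 0 -> 0 < t -> T t x = expR (a * t) *: x ->
  log_rate (T^~ x) t = (a + t^-1 * ln `|x|)%:E.
Proof.
move=> x0 t0 Tx; have nx0 : 0 < `|x| by rewrite normr_gt0.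
rewrite /log_rate Tx normrZ gtr0_norm ?expR_gt0//.
rewrite lne_EFin ?mulr_gt0 ?expR_gt0// lnM ?posrE ?expR_gt0// expRK.
by rewrite -EFinM mulrDr mulrCA mulVf ?mulr1// gt_eqF.
Qed.

Lemma eigenpair_rate (a b : R) x y : real_eigenpair T a b x y -> x != 0 ->
  exists2 u : nat -> R, u n @[n --> \oo] --> +oo &
    log_rate (T^~ x) (u n) @[n --> \oo] --> a%:E.
Proof.
move=> /eigenpair_recurrence[tau tau0 Ttau] x0.
have uoo : n.+1%:R * tau @[n --> \oo] --> +oo.
  apply/cvgryPge => A; exists (Num.truncn (A / tau)) => // n /= nA.
  rewrite -ler_pdivrMr//; apply/ltW; apply: lt_le_trans (truncnS_gt _) _.
  by rewrite ler_nat ltnS.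
exists (fun n => n.+1%:R * tau) => //.
have -> : (fun n => log_rate (T^~ x) (n.+1%:R * tau)) =
    (fun n => (a + (n.+1%:R * tau)^-1 * ln `|x|)%:E).
  by apply/funext => n; apply: log_rate_exp => //; rewrite mulr_gt0.
apply: cvg_EFin; first exact: nearW.
rewrite -[X in _ --> X]addr0; apply: cvgD; first exact: cvg_cst.
rewrite -(mul0r (ln `|x|)); apply: cvgMr_tmp.
by apply/gtr0_cvgV0 => //; apply: nearW => n; rewrite mulr_gt0.
Qed.

Lemma eigenpair_rate_unique (a b : R) x y (l : \bar R) :
  real_eigenpair T a b x y -> x != 0 ->
  log_rate (T^~ x) t @[t --> +oo] --> l -> l = a%:E.
Proof.
move=> xy x0 xl; have [u uoo ua] := eigenpair_rate xy x0.
exact: (cvg_unique _ (cvg_comp _ _ uoo xl) ua).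
Qed.

Lemma eigenpair_lyapunov (lambda : nat -> \bar R) (a b : R) x y :
  lyapunov_exponents T lambda -> real_eigenpair T a b x y -> x != 0 ->
  exists j, lambda j = a%:E.
Proof.
move=> hl xy x0; have [u uoo ua] := eigenpair_rate xy x0.
have : exists i, ~ growth_space T (lambda i) x.
  have : \forall i \near \oo, (lambda i < a%:E)%E.
    apply: (@lyap_lim _ _ _ _ hl [set z | (z < a%:E)%E]).
    by exists a; split; rewrite ?num_real.
  case=> i _ /(_ i (leqnn i)) /= lia; exists i => xi.
  have := le_trans (limf_esup_ge_subseq uoo ua) xi.
  by rewrite leNgt lia.
case=> i; elim: i => [|i IH] nx; first by case: nx; rewrite (lyap_setT hl).
(* If [x] misses the growth space of index [i] too, the induction hypothesis
   applies; otherwise [x] lies in the difference of two consecutive ones. *)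
have [xi|] := pselect (growth_space T (lambda i) x); last exact: IH.
exists i; case: (lyap_decr hl i) => [lt|[e e']]; last by case: nx; rewrite e' -e.
apply: (eigenpair_rate_unique xy x0).
by apply/(lyap_rate hl lt).
Qed.

End Rates.

(** * Differentiability of matrix semigroups *)

Section MatrixSemigroup.
Context (R : realType).

Lemma cvg_sumr (V : normedModType R) (I X : Type) (r : seq I) (F : set_system X)
    (f : I -> X -> V) (l : I -> V) : Filter F ->
  (forall i, f i t @[t --> F] --> l i) ->
  \sum_(i <- r) f i t @[t --> F] --> \sum_(i <- r) l i.
Proof. by move=> FF fl; apply: cvg_big => //; exact: add_continuous. Qed.

Lemma cvg_det n (W : R -> 'M[R]_n) (L : 'M[R]_n) (F : set_system R) : Filter F ->
  (forall i j, W t i j @[t --> F] --> L i j) ->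
  \det (W t) @[t --> F] --> \det L.
Proof.
move=> FF WL; apply: cvg_sumr => s; apply: cvgMl_tmp.
by apply: cvg_big => [|i _]; [exact: mul_continuous|exact: WL].
Qed.

Lemma ex_antiderivative (f : R -> R) : continuous f ->
  exists F : R -> R, forall x : R, 0 <= x -> is_derive x (1 : R) F (f x).
Proof.
move=> cf; pose mu := @lebesgue_measure R.
(* The lower bound [-1] makes [0] an interior point of the domain, so that the
   derivative at [0] is two-sided. *)
exists (fun x => \int[mu]_(t in `[(-1), x]) f t) => x x0.
have m1x : -1 < x by rewrite (lt_le_trans _ x0)// ltrN10.
have xu : x < x + 1 by rewrite ltrDl.
have fi : mu.-integrable `[(-1), x + 1] (EFin \o f).
  apply: continuous_compact_integrable; first exact: segment_compact.
  exact: continuous_subspaceT.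
have [dF F'] := continuous_FTC1_closed xu fi m1x (cf x).
by rewrite derive1E in F'; exact: DeriveDef dF F'.
Qed.

Lemma derive0_const (f : R -> R) (e : R) : 0 <= e ->
  (forall x : R, 0 <= x -> is_derive x (1 : R) f (0 : R)) -> f e = f 0.
Proof.
move=> e0 df.
have [||c _] := @MVT_segment R f (fun=> 0) 0 e e0.
- by move=> x; rewrite in_itv/= => /andP[/ltW x0 _]; exact: df.
- apply: continuous_in_subspaceT => x; rewrite inE/= in_itv/= => /andP[x0 _].
  by apply: differentiable_continuous; apply/derivable1_diffP; case: (df x x0).
by rewrite mul0r => /eqP; rewrite subr_eq0 => /eqP.
Qed.

(** Let [F] be an antiderivative of [M].  The semigroup law gives
    [M t * (F e - F 0) = F (t + e) - F t], whose right-hand side is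
    differentiable in [t].  For small [e > 0] the matrix [(F e - F 0) / e] is
    close to [M 0 = 1], so [F e - F 0] can be inverted and [M] itself is
    differentiable at [0]. *)
Lemma matrix_semigroup_derivable n (M : R -> 'M[R]_n) :
  (forall s t : R, 0 <= s -> 0 <= t -> M (s + t) = M s *m M t) -> M 0 = 1%:M ->
  (forall i j, continuous (fun t : R => M (Num.max 0 t) i j)) ->
  exists A : 'M[R]_n, forall i j,
    h^-1 * (M h i j - M 0 i j) @[h --> 0^'+] --> A i j.
Proof.
move=> MD M0 cM.
have /(_ _ _)/ex_antiderivative-/(_ _ _)/cid-F0 := cM.
pose F t := \matrix_(i, j) projT1 (F0 i j) t.
have dF i j (x : R) : 0 <= x -> is_derive x (1 : R) (fun t => F t i j) (M x i j).
  move=> x0; have := projT2 (F0 i j) x x0; rewrite (max_idPr x0).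
  by congr is_derive; apply/funext => t; rewrite mxE.
clearbody F.
(* Both sides vanish at [e = 0] and have the same derivative in [e]. *)
have FD (e t : R) : 0 <= e -> 0 <= t -> M t *m (F e - F 0) = F (t + e) - F t.
  move=> e0 t0.
  have E : M t *m F e - F (t + e) = M t *m F 0 - F (t + 0).
    apply/matrixP => i j.
    apply: (@derive0_const (fun e => (M t *m F e - F (t + e)) i j) e e0) => x x0.
    have tx0 : 0 <= t + x by rewrite addr_ge0.
    have dsum := is_derive_sum (fun k : 'I_n => is_deriveZ (M t i k) (dF k j x x0)).
    have dshift : is_derive x (1 : R) ((fun u => F u i j) \o +%R t) (M (t + x) i j * 1).
      apply: is_derive1_comp; first exact: dF.
      by apply: is_derive_eq; rewrite add0r.
    move: (is_deriveB dsum dshift); congr (is_derive _ _ _ _).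
      by apply/funext => u; rewrite !mxE -[LHS]/(_ - F (t + u) i j) fct_sumE.
    by rewrite mulr1 MD// mxE subrr.
  rewrite mulmxBr -[X in X - _](subrK (F (t + e))) E addr0.
  by rewrite addrC !addrA addNr add0r addrC.
have dF0 i j (x : R) (x0 : 0 <= x) := is_derive_right (dF i j x x0).
have [e [e0 uV]] : exists e : R, 0 < e /\ F e - F 0 \in unitmx.
  have : \det (h^-1 *: (F h - F 0)) @[h --> 0^'+] --> \det (1%:M : 'M[R]_n).
    apply: cvg_det => i j; rewrite -M0.
    move: (dF0 i j 0 (lexx _)); apply: cvg_trans; apply: near_eq_cvg.
    by near=> h; rewrite add0r !mxE.
  rewrite det1 => /cvgr_neq0/(_ (oner_neq0 _)) dW.
  have : \forall h \near (0 : R)^'+, 0 < h /\ \det (h^-1 *: (F h - F 0)) != 0.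
    by near=> h; split; [near: h; exact: nbhs_right_gt|near: h].
  case/filter_ex => h [h0 dh]; exists h; split => //.
  by rewrite -(unitmxZ _ (a := h^-1)) ?unitmxE ?unitfE// invr_eq0 gt_eqF.
exists ((M e - M 0) *m invmx (F e - F 0)) => i j.
have -> : ((M e - M 0) *m invmx (F e - F 0)) i j =
    \sum_k (M e i k - M 0 i k) * invmx (F e - F 0) k j.
  by rewrite mxE; apply: eq_bigr => k _; rewrite !mxE.
have : \sum_k (h^-1 * (F (e + h) i k - F e i k) - h^-1 * (F (0 + h) i k - F 0 i k))
    * invmx (F e - F 0) k j @[h --> 0^'+] -->
    \sum_k (M e i k - M 0 i k) * invmx (F e - F 0) k j.
  apply: cvg_sumr => k; apply: cvgMr_tmp; apply: cvgB; apply: dF0 => //.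
  exact: ltW.
apply: cvg_trans; apply: near_eq_cvg; near=> h.
have h0 : 0 <= h by near: h; exact: nbhs_right_ge.
have -> : M h i j - M 0 i j = ((M h - M 0) *m (F e - F 0) *m invmx (F e - F 0)) i j.
  by rewrite mulmxK// !mxE.
rewrite mulmxBl !FD ?(ltW e0)// mxE mulr_sumr; apply: eq_bigr => k _.
by rewrite !add0r !mxE [h + e]addrC; ring.
Unshelve. all: by end_near. Qed.

End MatrixSemigroup.

(** * Finite-dimensional invariant subspaces *)

Section FiniteDimension.
Context (R : realType).

Definition combination (B : lmodType R) n (e : 'I_n -> B) (c : 'rV[R]_n) : B :=
  \sum_k c 0 k *: e k.

Definition independent (B : lmodType R) n (e : 'I_n -> B) : Prop :=
  forall c, combination e c = 0 -> c = 0.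

Section Algebra.
Context (B : lmodType R) (n : nat) (e : 'I_n -> B).

Lemma combinationD c d : combination e (c + d) = combination e c + combination e d.
Proof.
by rewrite -big_split; apply: eq_bigr => k _; rewrite mxE scalerDl.
Qed.

Lemma combinationZ a c : combination e (a *: c) = a *: combination e c.
Proof.
by rewrite scaler_sumr; apply: eq_bigr => k _; rewrite mxE scalerA.
Qed.

Lemma combinationB c d : combination e (c - d) = combination e c - combination e d.
Proof. by rewrite combinationD -[- d]scaleN1r combinationZ scaleN1r. Qed.

Lemma combination_delta i : combination e (delta_mx 0 i) = e i.
Proof.
rewrite /combination (bigD1 i)//= mxE !eqxx scale1r big1 ?addr0// => k /negbTE ki.
by rewrite mxE ki andbF scale0r.
Qed.

Lemma combination_inj c d : independent e ->
  combination e c = combination e d -> c = d.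
Proof.
move=> ind cd; apply/eqP; rewrite -subr_eq0; apply/eqP/ind.
by rewrite combinationB cd subrr.
Qed.

End Algebra.

(** Induction on the length of a spanning family: a vector with a nonzero
    coefficient in a linear relation can be dropped. *)
Lemma ex_basis (B : lmodType R) (V : set B) : finite_dim V ->
  exists n (e : 'I_n -> B), independent e /\ V = range (combination e).
Proof.
case=> n [e ->].
have -> : range (fun c : 'I_n -> R => \sum_(k < n) c k *: e k) =
    range (combination e).
  apply/seteqP; split=> _ [c _ <-].
    by exists (\row_k c k) => //; apply: eq_bigr => k _; rewrite mxE.
  by exists (c 0).
elim: n e => [|n IH] e.
  by exists 0%N, e; split => // c _; apply/rowP => -[].
have [ind|/existsNP[d /not_implyP[de d0]]] := pselect (independent e).
  by exists n.+1, e.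
have [j dj0] : exists j, d 0 j != 0.
  apply/existsP; apply: contra_notT d0 => /existsPn dz.
  by apply/rowP => j; rewrite mxE; apply/eqP; rewrite -[_ == _]negbK dz.
have [m [f [indf ef]]] := IH (fun k => e (lift j k)).
exists m, f; split => //; rewrite -ef; apply/seteqP; split=> _ [c _ <-].
  (* Subtracting a multiple of the relation [d] clears the coefficient [j]. *)
  exists (\row_k (c 0 (lift j k) - c 0 j / d 0 j * d 0 (lift j k))) => //.
  have -> : combination e c = combination e (c - (c 0 j / d 0 j) *: d).
    by rewrite combinationB combinationZ de scaler0 subr0.
  rewrite {2}/combination (bigD1_ord j)//= !mxE divfK// subrr scale0r add0r.
  by apply: eq_bigr => k _; rewrite !mxE.
exists (\row_k oapp (c 0) 0 (unlift j k)) => //.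
rewrite /combination (bigD1_ord j)//= mxE unlift_none scale0r add0r.
by apply: eq_bigr => k _; rewrite mxE liftK.
Qed.

Lemma coord_le_norm n (c : 'rV[R]_n) k : `|c 0 k| <= `|c|.
Proof.
rewrite [leRHS]/Num.norm/= mx_normrE.
by apply: (le_bigmax _ (fun i : 'I_1 * 'I_n => `|c i.1 i.2|) (0, k)).
Qed.

(** The norm of a combination attains a minimum on the compact unit sphere of
    coefficient vectors, and this minimum is positive by independence. *)
Lemma coordinates_bounded (B : normedModType R) n (e : 'I_n -> B) :
  independent e ->
  exists2 K : R, 0 <= K & forall (c : 'rV[R]_n) k, `|c 0 k| <= K * `|combination e c|.
Proof.
move=> ind; pose S := [set c : 'rV[R]_n | `|c| = 1].
have normS c : c != 0 -> S (`|c|^-1 *: c).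
  by move=> c0; rewrite /S/= normrZ normfV normr_id mulVf// normr_eq0.
have [S0|nS] := pselect (S !=set0); last first.
  exists 0 => // c k; have [->|c0] := eqVneq c 0.
    by rewrite mxE normr0 mul0r.
  by case: nS; exists (`|c|^-1 *: c); exact: normS.
have cS : compact S.
  apply: bounded_closed_compact.
    by exists 1; split; rewrite ?num_real// => r r1 c /= ->; exact: ltW.
  have /continuous_closedP/(_ [set 1]) := @norm_continuous R 'rV[R]_n.
  by apply; exact: closed_eq.
have cc (c : 'rV[R]_n) : combination e d @[d --> c] --> combination e c.
  apply: cvg_sumr => [|k]; first exact: nbhs_filter.
  exact: cvgZr_tmp (@coord_continuous R 1 n 0 k c).
have cf : continuous (fun c : 'rV[R]_n => `|combination e c|).
  by move=> c; exact: cvg_norm (cc c).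
have [c0 /[!inE] c0S minc0] := EVT_min_rV S0 cS (continuous_subspaceT cf).
have m0 : 0 < `|combination e c0|.
  rewrite normr_gt0; apply/eqP => /ind c00.
  by move: c0S; rewrite c00 /S/= normr0 => /esym/eqP; rewrite oner_eq0.
exists `|combination e c0|^-1 => [|c k]; first by rewrite invr_ge0.
have [->|cn0] := eqVneq c 0; first by rewrite mxE normr0 mulr_ge0// invr_ge0.
apply: le_trans (coord_le_norm c k) _.
have := minc0 _ (mem_set (normS c cn0)).
rewrite combinationZ normrZ normfV normr_id ler_pdivlMl ?normr_gt0// mulrC.
by rewrite ler_pdivlMl.
Qed.

End FiniteDimension.

(** The rows [p] and [q] are the real and imaginary parts of a complex
    eigenvector of [A] for [a + i b]. *)
Lemma real_matrix_eigenpair (R : realType) n (A : 'M[R]_n) : (0 < n)%N ->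
  exists (a b : R) (p q : 'rV[R]_n), [/\ (p != 0) || (q != 0),
    p *m A = a *: p - b *: q & q *m A = b *: p + a *: q].
Proof.
move=> n0; pose AC := map_mx (real_complex R) A.
have /closed_rootP[mu] : size (char_poly AC) != 1 by rewrite size_char_poly -lt0n.
rewrite -eigenvalue_root_char => /eigenvalueP[w wA w0].
exists (complex.Re mu), (complex.Im mu), (map_mx (@complex.Re R) w),
  (map_mx (@complex.Im R) w).
have wE j : \sum_k w 0 k * (A k j)%:C%C = mu * w 0 j.
  have /matrixP/(_ 0 j) := wA; rewrite !mxE => <-.
  by apply: eq_bigr => k _; rewrite mxE.
have ReD : {morph @complex.Re R : x y / x + y} by case=> ? ? [].
have ImD : {morph @complex.Im R : x y / x + y} by case=> ? ? [].
split.
- apply: contraNT w0; rewrite negb_or !negbK => /andP[/eqP p0 /eqP q0].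
  apply/eqP/rowP => k; have /rowP/(_ k) := p0; have /rowP/(_ k) := q0.
  by rewrite !mxE; case: (w 0 k) => ? ? /= -> ->.
- apply/rowP => j; rewrite !mxE.
  have /(congr1 (@complex.Re R)) := wE j.
  rewrite (big_morph _ ReD (erefl : complex.Re 0 = 0)).
  rewrite [RHS](_ : _ = complex.Re mu * complex.Re (w 0 j) -
    complex.Im mu * complex.Im (w 0 j)); last by case: (mu); case: (w 0 j).
  move=> <-; apply: eq_bigr => k _; rewrite mxE.
  by case: (w 0 k) => u v /=; rewrite mulr0 subr0.
- apply/rowP => j; rewrite !mxE.
  have /(congr1 (@complex.Im R)) := wE j.
  rewrite (big_morph _ ImD (erefl : complex.Im 0 = 0)).
  rewrite [RHS](_ : _ = complex.Im mu * complex.Re (w 0 j) +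
    complex.Re mu * complex.Im (w 0 j)); last first.
    by case: (mu); case: (w 0 j) => ? ? ? ? /=; rewrite addrC.
  move=> <-; apply: eq_bigr => k _; rewrite mxE.
  by case: (w 0 k) => u v /=; rewrite mulr0 add0r.
Qed.

Section FiniteDimensionalPart.
Context (R : realType) (B : completeNormedModType R) (T : R -> B -> B).
Context (hT : C0_semigroup T).

(** The semigroup law turns the difference of two values of an orbit into
    [T_u (T_h x - x)], where [u] is the smaller time; the local bound on [T_u]
    gives continuity from the left as well as from the right.  Truncating the
    time at [0] yields a function that is continuous on the whole line. *)
Lemma semigroup_orbit_continuous x : continuous (fun t : R => T (Num.max 0 t) x).
Proof.
move=> t; apply/cvgrPdist_lt => eps eps0.
set tau := Num.max 0 t + 1.
have [C C1 hC] := semigroup_bounded hT tau.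
have C0 : 0 < C by exact: lt_le_trans C1.
have /cvgrPdist_lt/(_ (eps / C) (divr_gt0 eps0 C0))[d /= d0 hd] :=
  @C0_strong _ _ _ hT x.
have small h : 0 <= h -> h < d -> `|T h x - x| < eps / C.
  rewrite le_eqVlt => /orP[/eqP<-|h0 h1].
    by rewrite (C0_id hT) subrr normr0 divr_gt0.
  by rewrite distrC; apply: hd => //=; rewrite sub0r normrN gtr0_norm.
have main u v : 0 <= u -> u <= v -> v <= tau -> v - u < d ->
    `|T v x - T u x| < eps.
  move=> u0 uv vtau vud.
  have vu0 : 0 <= v - u by rewrite subr_ge0.
  rewrite -[in T v](subrKC u v) (C0_add hT _ u0 vu0) -(semigroupB hT)//.
  apply: le_lt_trans (hC _ _ u0 (le_trans uv vtau)) _.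
  by rewrite mulrC -ltr_pdivlMr//; exact: small.
near=> s.
have stau : Num.max 0 s <= tau.
  rewrite /tau ge_max addr_ge0 ?le_max ?lexx//=.
  have : `|t - s| < 1 by near: s; apply: cvgr_dist_lt.
  rewrite ltr_distl ltrBlDr => /andP[/ltW/le_trans + _]; apply.
  by rewrite lerD2r le_max lexx orbT.
have tts : Num.max 0 t <= tau by rewrite /tau lerDl.
have dist : `|Num.max 0 t - Num.max 0 s| < d.
  have : `|t - s| < d by near: s; apply: cvgr_dist_lt.
  apply: le_lt_trans; have := ler_norm (t - s); have := ler_norm (s - t).
  rewrite [`|s - t|]distrC ler_norml.
  by case: (leP 0 t); case: (leP 0 s) => *; apply/andP; split; lra.
have m0 u : 0 <= Num.max 0 u :> R by rewrite le_max lexx.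
have [ts|/ltW st] := leP (Num.max 0 t) (Num.max 0 s).
  rewrite distrC main// -(ger0_norm (_ : 0 <= _ - _)) ?subr_ge0//.
  by rewrite distrC.
by rewrite main// -(ger0_norm (_ : 0 <= _ - _)) ?subr_ge0.
Unshelve. all: by end_near. Qed.

(** Coordinates are bounded by the norm, so the matrix of [T_t] in the basis
    inherits the continuity of the orbits of the basis vectors and is
    differentiable at [0].  Every vector of the subspace is thus in the domain
    of the generator, which maps the subspace into itself. *)
Lemma invariant_space_generator n (e : 'I_n -> B) : independent e ->
  (forall t : R, 0 <= t -> forall c, range (combination e) (T t (combination e c))) ->
  exists A : 'M[R]_n, forall c,
    h^-1 *: (T h (combination e c) - combination e c) @[h --> 0^'+] -->
    combination e (c *m A).
Proof.
move=> ind inv.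
have /choice[m hm] : forall t : R, exists M : 'M[R]_n,
    0 <= t -> forall i, T t (e i) = combination e (row i M).
  move=> t; have [t0|t0] := pselect (0 <= t); last by exists 0.
  have /choice[f hf] : forall i, exists c, T t (e i) = combination e c.
    move=> i; have [c _ ce] := inv t t0 (delta_mx 0 i).
    by exists c; rewrite ce combination_delta.
  by exists (\matrix_i f i) => _ i; rewrite rowK hf.
have Tcomb t c : 0 <= t -> T t (combination e c) = combination e (c *m m t).
  move=> t0; rewrite [LHS](semigroup_sum hT)// /combination.
  rewrite (eq_bigr (fun i => \sum_k (c 0 i * m t i k) *: e k)); last first.
    move=> i _; rewrite hm// /combination scaler_sumr; apply: eq_bigr => k _.
    by rewrite mxE scalerA.
  by rewrite exchange_big; apply: eq_bigr => k _; rewrite mxE scaler_suml.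
have mE X Y : (forall c : 'rV[R]_n, combination e (c *m X) = combination e (c *m Y)) ->
    X = Y.
  move=> XY; apply/row_matrixP => i; rewrite !rowE.
  by apply: (combination_inj ind).
have m0 : m 0 = 1%:M.
  by apply: mE => c; rewrite -Tcomb// (C0_id hT) mulmx1.
have mD (s t : R) : 0 <= s -> 0 <= t -> m (s + t) = m s *m m t.
  move=> s0 t0; apply: mE => c; rewrite -Tcomb ?addr_ge0// addrC.
  by rewrite (C0_add hT)// !Tcomb// mulmxA.
have [K K0 hK] := coordinates_bounded ind.
have mc i j : continuous (fun t : R => m (Num.max 0 t) i j).
  move=> t; apply/cvgrPdist_le => eps eps0.
  have K1 : 0 < K + 1 by rewrite ltr_wpDl.
  have /cvgrPdist_le/(_ (eps / (K + 1)) (divr_gt0 eps0 K1)) :=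
    @semigroup_orbit_continuous (e i) t.
  apply: filterS => s; have max0 u : 0 <= Num.max 0 u :> R by rewrite le_max lexx.
  rewrite !hm// -combinationB => hs.
  have := hK (row i (m (Num.max 0 t)) - row i (m (Num.max 0 s))) j.
  rewrite !mxE => /le_trans; apply.
  apply: le_trans (_ : (K + 1) * (eps / (K + 1)) <= _).
    by rewrite ler_pM// lerDl.
  by rewrite mulrC divfK// gt_eqF.
have [A hA] := matrix_semigroup_derivable mD m0 mc.
exists A => c.
have -> : combination e (c *m A) = \sum_k (\sum_i c 0 i * A i k) *: e k.
  by apply: eq_bigr => k _; rewrite mxE.
have : \sum_k (\sum_i c 0 i * (h^-1 * (m h i k - m 0 i k))) *: e k
    @[h --> 0^'+] --> \sum_k (\sum_i c 0 i * A i k) *: e k.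
  apply: cvg_sumr => k; apply: cvgZr_tmp; apply: cvg_sumr => i.
  by apply: cvgMl_tmp; exact: hA.
apply: cvg_trans; apply: near_eq_cvg; near=> h.
have h0 : 0 <= h by near: h; exact: nbhs_right_ge.
rewrite Tcomb// -[X in _ - X](_ : combination e (c *m m 0) = _); last first.
  by rewrite m0 mulmx1.
rewrite -combinationB -combinationZ; apply: eq_bigr => k _; congr (_ *: _).
by rewrite !mxE -sumrB mulr_sumr; apply: eq_bigr => i _; ring.
Unshelve. all: by end_near. Qed.

End FiniteDimensionalPart.

(** * Point spectrum and Lyapunov exponents *)

Section PointSpectrum.
Context (R : realType) (B : completeNormedModType R) (T : R -> B -> B).
Context (hT : C0_semigroup T).

Lemma generator_cvg x : generator_dom T x ->
  h^-1 *: (T h x - x) @[h --> 0^'+] --> generator T x.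
Proof. by []. Qed.

Lemma generator_eq x l : h^-1 *: (T h x - x) @[h --> 0^'+] --> l ->
  generator_dom T x /\ generator T x = l.
Proof.
move=> xl; split; first by apply/cvg_ex; exists l.
exact: cvg_lim xl.
Qed.

(** By linearity of the generator, a failure of injectivity is a nonzero kernel
    vector, here split into its real and imaginary parts. *)
Lemma point_spectrum_eigenpair (a b : R) :
  point_spectrum (generator_dom T) (generator T) (Complex a b) <->
  exists x y, (x != 0) || (y != 0) /\ real_eigenpair T a b x y.
Proof.
split=> [/existsNP[[x y]] | [x [y [xy0 [hx hy]]]]].
  move=> /existsNP[[x' y']] /not_implyP[/set_mem[/= dx dy]].
  move=> /not_implyP[/set_mem[/= dx' dy']] /not_implyP[eqz neq].
  have := congr1 fst eqz; have := congr1 snd eqz => /= eqy eqx.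
  exists (x - x'), (y - y'); split.
    rewrite -negb_and !subr_eq0; apply/negP => /andP[/eqP xx /eqP yy].
    by apply: neq; rewrite xx yy.
  have diff u u' : generator_dom T u -> generator_dom T u' ->
      h^-1 *: (T h (u - u') - (u - u')) @[h --> 0^'+] -->
      generator T u - generator T u'.
    move=> du du'.
    have : h^-1 *: (T h u - u) - h^-1 *: (T h u' - u') @[h --> 0^'+] -->
        generator T u - generator T u' by exact: cvgB.
    apply: cvg_trans; apply: near_eq_cvg; near=> h.
    have h0 : 0 <= h by near: h; exact: nbhs_right_ge.
    rewrite (semigroupB hT)// -scalerBr; congr (_ *: _).
    by rewrite [in LHS]opprD addrACA -opprD.
  have swap (p q p' q' : B) : p - q = p' - q' -> p - p' = q - q'.
    by move=> pq; rewrite -[p](subrK q) pq addrC !addrA addNr add0r addrC.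
  split.
    rewrite [X in _ --> X](_ : _ = generator T x - generator T x'); first exact: diff.
    by rewrite -(swap _ _ _ _ eqx) !scalerBr !opprD !opprK addrACA.
  rewrite [X in _ --> X](_ : _ = generator T y - generator T y'); first exact: diff.
  by rewrite -(swap _ _ _ _ eqy) !scalerBr !opprD addrACA.
have [dx Lx] := generator_eq hx; have [dy Ly] := generator_eq hy.
have [d0 L0] : generator_dom T 0 /\ generator T 0 = 0.
  apply: generator_eq; apply: cvg_near_cst; near=> h.
  have h0 : 0 <= h by near: h; exact: nbhs_right_ge.
  have := semigroupB hT 0 0 h0; rewrite !subrr => ->.
  by rewrite subrr scaler0.
move=> /(_ (x, y) (0, 0)); rewrite !inE => /(_ (conj dx dy) (conj d0 d0)) zero.
have : (x, y) = (0, 0) :> complexification B.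
  apply: zero; rewrite /cplx_op /= Lx Ly L0.
  congr pair => /=.
    by rewrite !scaler0 !subrr.
  by rewrite !scaler0 addr0 !subrr.
by case=> x0 y0; move: xy0; rewrite x0 y0 eqxx.
Unshelve. all: by end_near. Qed.

End PointSpectrum.

Theorem theorem7 (R : realType) (B : completeNormedModType R)
  (T : R -> B -> B) (r : R) (lambda : nat -> \bar R)
  (hT : C0_semigroup T)
  (hcompact : forall t : R, 0 <= t -> r <= t -> compact_operator (T t))
  (hlambda : lyapunov_exponents T lambda) :
  (forall mu : R[i], point_spectrum (generator_dom T) (generator T) mu ->
     exists (j : nat) (b : R),
       lambda j <> -oo%E /\ mu = Complex (fine (lambda j)) b) /\
  (forall j : nat, lambda j <> -oo%E ->
     exists b : R,
       point_spectrum (generator_dom T) (generator T)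
         (Complex (fine (lambda j)) b)).
Proof.
split=> [[a b] /(point_spectrum_eigenpair hT)[x [y [xy0 xy]]]|j lj].
  have [j lj] : exists j, lambda j = a%:E.
    case/orP: xy0 => [x0|y0]; first exact: (eigenpair_lyapunov hT hlambda xy x0).
    exact: (eigenpair_lyapunov hT hlambda (real_eigenpair_rot hT xy) y0).
  by exists j, b; rewrite lj.
have lt : (lambda j.+1 < lambda j)%E by case: (lyap_decr hlambda j) => // -[].
have [H [[finH nzH invH _ rateH _] _]] := lyap_oseledets hlambda lt.
have [n [e [ind HE]]] := ex_basis finH.
have n0 : (0 < n)%N.
  rewrite lt0n; apply/eqP => n0; apply: nzH; rewrite HE; subst n.
  apply/seteqP; split=> [_ [c _ <-]|_ ->]; first by rewrite /combination big_ord0.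
  by exists 0 => //; rewrite /combination big_ord0.
have [A hA] : exists A : 'M[R]_n, forall c,
    h^-1 *: (T h (combination e c) - combination e c) @[h --> 0^'+] -->
    combination e (c *m A).
  apply: invariant_space_generator => // t t0 c.
  by rewrite -HE -(invH t t0); exists (combination e c) => //; rewrite HE; exists c.
have [a [b [p [q [pq0 pA qA]]]]] := real_matrix_eigenpair A n0.
have xy : real_eigenpair T a b (combination e p) (combination e q).
  split; first by rewrite -!combinationZ -combinationB -pA.
  by rewrite -!combinationZ -combinationD -qA.
have inH c : H (combination e c) by rewrite HE; exists c.
have nz c : c != 0 -> combination e c != 0 by apply: contra_neq => /ind.
have -> : lambda j = a%:E.
  case/orP: pq0 => [p0|q0].
    by apply: (eigenpair_rate_unique hT xy (nz p p0)); apply: rateH => //; apply/eqP/nz.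
  apply: (eigenpair_rate_unique hT (real_eigenpair_rot hT xy) (nz q q0)).
  by apply: rateH => //; apply/eqP/nz.
exists b; apply/(point_spectrum_eigenpair hT).
exists (combination e p), (combination e q); split => //.
by case/orP: pq0 => /nz ->; rewrite ?orbT.
Qed.
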